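(* There is a universal constant $C>0$ such that the following holds. Let $G$ be a weighted finite graph, let $f_1,\ldots,f_k:V\to\mathbb{R}$ be orthonormal in $l^2(V,\mu)$, and let $F:V\to\mathbb{R}^k$, $F(v)=(f_1(v),\ldots,f_k(v))$. Then there exists a $k$-sub-bipartition $\{(V_{2i-1},V_{2i})\}_{i=1}^k$ of $V$ such that for each $1\leq i\leq k$, \[ \frac{(1-\overline{\phi}(V_{2i-1},V_{2i}))^2}{2}\leq1-\sqrt{1-(1-\overline{\phi}(V_{2i-1},V_{2i}))^2}\leq Ck^6\,\overline{\mathcal{R}}(F). \]
   Context: $G=(V,E,w)$ is a finite undirected graph without self-loops, with positive symmetric edge weights $w_{uv}$ ($w_{uv}=0$ for non-edges), degrees $d_u=\sum_vw_{uv}$ (implicitly positive), $\mu(u)=d_u$, and $(f,g)_\mu=\sum_u\mu(u)f(u)g(u)$. $|E(A,B)|:=\sum_{u\in A,v\in B}w_{uv}$, $\mathrm{vol}(A)=\sum_{u\in A}d_u$. For disjoint $V_1,V_2$ with $V_1\cup V_2\neq\emptyset$, $\overline{\phi}(V_1,V_2)=2|E(V_1,V_2)|/\mathrm{vol}(V_1\cup V_2)$. A $k$-sub-bipartition is a collection of $k$ pairs $(V_1,V_2),\ldots,(V_{2k-1},V_{2k})$ of pairwise disjoint subsets of $V$ with $V_{2i-1}\cup V_{2i}\neq\emptyset$ for each $i$. For a map $F:V\to\mathbb{R}^k$ not identically zero, \[ \overline{\mathcal{R}}(F):=\frac{\sum_{\{u,v\}\in E}\|F(u)+F(v)\|^2w_{uv}}{\sum_{u\in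 V}\|F(u)\|^2\mu(u)}, \] the numerator summing over each edge once. *)

(* Defs.v *)
From mathcomp Require Import all_boot all_order all_algebra.
From mathcomp Require Import reals Rstruct.
Set Implicit Arguments. Unset Strict Implicit. Unset Printing Implicit Defensive.
Import Order.TTheory GRing.Theory Num.Theory.
Local Open Scope ring_scope.

Section Graph.
Variables (R : realType) (V : finType) (w : V -> V -> R).

(* weighted graph: nonnegative symmetric weights, no self-loops,
   positive degrees; w u v = 0 means non-edge *)
Definition deg (u : V) : R := \sum_(v : V) w u v.

Definition is_weighted_graph : Prop :=
  [/\ forall u v, 0 <= w u v,
      forall u v, w u v = w v u,
      forall u, w u u = 0 &
      forall u, 0 < deg u].

Definition inner_mu (f g : V -> R) : R := \sum_(u : V) deg u * f u * g u.

Definition orthonormal_mu (k : nat) (f : 'I_k -> V -> R) : Prop :=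
  forall i j : 'I_k, inner_mu (f i) (f j) = (i == j)%:R.

Definition cut (A B : {set V}) : R := \sum_(u in A) \sum_(v in B) w u v.
Definition vol (A : {set V}) : R := \sum_(u in A) deg u.

Definition phibar (A B : {set V}) : R := 2 * cut A B / vol (A :|: B).

Definition sub_bipartition (k : nat) (P Q : 'I_k -> {set V}) : Prop :=
  [/\ forall i, [disjoint P i & Q i],
      forall i j, i != j -> [disjoint P i & P j],
      forall i j, i != j -> [disjoint Q i & Q j],
      forall i j, i != j -> [disjoint P i & Q j] &
      forall i, P i :|: Q i != set0].

Definition sqnorm_sum (k : nat) (f : 'I_k -> V -> R) (u v : V) : R :=
  \sum_(i < k) (f i u + f i v) ^+ 2.
Definition sqnorm (k : nat) (f : 'I_k -> V -> R) (u : V) : R :=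
  \sum_(i < k) (f i u) ^+ 2.

(* dual Rayleigh quotient: each edge {u,v} counted once (u before v
   in the enumeration of V; no self-loops) *)
Definition rayleigh_bar (k : nat) (f : 'I_k -> V -> R) : R :=
  (\sum_(u : V) \sum_(v : V | (enum_rank u < enum_rank v)%N)
      sqnorm_sum f u v * w u v)
  / (\sum_(u : V) sqnorm f u * deg u).

End Graph.

(* Main.v *)
Require Import Defs.
From mathcomp Require Import all_boot all_order all_algebra.
From mathcomp Require Import reals Rstruct.
From mathcomp Require Import ring lra zify.
Set Implicit Arguments. Unset Strict Implicit.
Import Order.TTheory GRing.Theory Num.Theory.
Local Open Scope ring_scope.

(** Orthonormality makes F isotropic: [\sum_u mu(u) <y, F u>^2 = |y|^2] for every
    y, and [F] has total mass k.  Hence vertices whose directions [F u / |F u|]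
    agree up to sign and up to a squared distance 1/(4k) carry mass at most
    4k/(4k-1).  Cut the sphere along a grid of cubes that is symmetric under
    [x |-> -x], has Q = 6k cells per unit length, and is one of N = 8k^2
    translates.  Multiplying [F] by a cutoff that vanishes on the cell walls loses
    on average at most a fraction k/N of the mass, and on average over the
    translates it increases the edge energy by a factor O(Q^2 N) = O(k^4) only.
    For a good translate, gluing antipodal cells and grouping them greedily gives
    k disjointly supported maps of mass at least 1/2 and energy O(k^4) times that
    of [F], that is, O(k^5) times the Rayleigh quotient.  A best coordinate of each
    of them is fed to the sweep-cut argument of the dual Cheeger inequality. *)

(** * The sweep-cut argument *)

(** Averaging without division; keeping [0 < b p] makes the selected ratio meaningful. If the head
    is no witness, the tail inherits both hypotheses: either [b x = 0], or [a x] exceeds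
    [l * b x]. *)
Lemma exists_mediant (R : realType) (I : eqType) (s : seq I) (a b : I -> R) (l : R) :
    {in s, forall p, 0 <= a p} -> {in s, forall p, 0 <= b p} ->
    0 < \sum_(p <- s) b p -> \sum_(p <- s) a p <= l * \sum_(p <- s) b p ->
  exists2 p, p \in s & 0 < b p /\ a p <= l * b p.
Proof.
elim: s => [|x s IHs] a0 b0; first by rewrite big_nil ltxx.
have ax0 : 0 <= a x by rewrite a0 ?mem_head.
have bx0 : 0 <= b x by rewrite b0 ?mem_head.
have as0 : {in s, forall p, 0 <= a p} by move=> p ps; rewrite a0 // inE ps orbT.
have bs0 : {in s, forall p, 0 <= b p} by move=> p ps; rewrite b0 // inE ps orbT.
rewrite !big_cons => sb sa.
have sa0 : 0 <= \sum_(p <- s) a p by rewrite big_seq; apply: sumr_ge0.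
have sb0 : 0 <= \sum_(p <- s) b p by rewrite big_seq; apply: sumr_ge0.
have [/andP[bx ax]|] := boolP ((0 < b x) && (a x <= l * b x)).
  by exists x; rewrite ?mem_head.
move=> nx; suff : 0 < \sum_(p <- s) b p
    /\ \sum_(p <- s) a p <= l * \sum_(p <- s) b p.
  by case=> /(IHs as0 bs0) H /H[p ps hp]; exists p; rewrite // inE ps orbT.
have [bx|bx] := eqVneq (b x) 0; first by split; move: sb sa; rewrite bx; lra.
move: nx; rewrite lt_neqAle eq_sym bx bx0 /= -ltNge => ax.
split; last by lra.
rewrite lt_neqAle sb0 andbT eq_sym; apply/eqP => e.
by move: sa; rewrite e; lra.
Qed.

(** Lagrange's identity: twice the defect is a double sum of weighted squares. *)
Lemma weighted_cauchy_schwarz (R : realType) (I : finType) (w a b : I -> R) :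
  (forall i, 0 <= w i) ->
  (\sum_i w i * (a i * b i)) ^+ 2
    <= (\sum_i w i * a i ^+ 2) * (\sum_i w i * b i ^+ 2).
Proof.
move=> w0.
suff: 0 <= 2 * ((\sum_i w i * a i ^+ 2) * (\sum_i w i * b i ^+ 2)
               - (\sum_i w i * (a i * b i)) ^+ 2) by lra.
have -> : 2 * ((\sum_i w i * a i ^+ 2) * (\sum_i w i * b i ^+ 2)
               - (\sum_i w i * (a i * b i)) ^+ 2)
  = \sum_i \sum_j w i * w j * (a i * b j - a j * b i) ^+ 2.
  have e (x y : I -> R) : (\sum_i x i) * (\sum_i y i) = \sum_i \sum_j x i * y j.
    by rewrite mulr_suml; apply: eq_bigr => i _; rewrite mulr_sumr.
  set X := (\sum_i w i * a i ^+ 2); set Y := (\sum_i w i * b i ^+ 2).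
  set Z := (\sum_i w i * (a i * b i)).
  have -> : 2 * (X * Y - Z ^+ 2) = X * Y + Y * X - 2 * (Z * Z) by ring.
  rewrite !e mulr_sumr -big_split -sumrB /=; apply: eq_bigr => i _.
  rewrite mulr_sumr -big_split -sumrB /=; apply: eq_bigr => j _.
  ring.
apply: sumr_ge0 => i _; apply: sumr_ge0 => j _.
by rewrite mulr_ge0 ?sqr_ge0 // mulr_ge0.
Qed.

(** A finite substitute for integrating over thresholds: [p.1] is the thickness of a layer and [p.2]
    its threshold. The induction peels off the least positive value, which shrinks the support. *)
Lemma layer_cake (R : realType) (V : finType) (g : V -> R) :
  (forall v, 0 <= g v) ->
  exists2 s : seq (R * R), {in s, forall p, 0 <= p.1 /\ 0 <= p.2} &
    forall v, g v = \sum_(p <- s) p.1 * (p.2 < g v)%R%:R.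
Proof.
have [n] := ubnP #|[pred v | 0 < g v]|; elim: n g => // n IHn g /ltnSE gn g0.
have [z|v0] := pickP [pred v | 0 < g v]; last first.
  exists [::] => // v; rewrite big_nil; have := v0 v => /= gv.
  by apply/eqP; rewrite eq_le g0 leNgt gv.
move=> gz; have [y gy ymin] := @arg_minP _ _ V z [pred v | 0 < g v] g gz.
rewrite inE in gy.
pose g' v := if 0 < g v then g v - g y else 0.
have g'0 v : 0 <= g' v.
  by rewrite /g'; case: ifP => // gv; rewrite subr_ge0; apply: ymin.
case: (IHn g') => // [|s s0 hs].
  apply: leq_trans gn; apply: proper_card; apply/properP; split.
    by apply/subsetP => v; rewrite !inE /g'; case: ifP => //; rewrite ltxx.
  by exists y; rewrite !inE // /g' gy subrr ltxx.
(* The bottom layer covers the whole support with thickness [g y]; the layers of the remainder move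
   up by [g y]. *)
exists ((g y, 0) :: [seq (p.1, p.2 + g y) | p <- s]).
  move=> p; rewrite inE => /orP[/eqP -> /=|/mapP[q /s0[q1 q2] -> /=]].
    by rewrite ltW.
  by split=> //; rewrite addr_ge0 // ltW.
move=> v; rewrite big_cons big_map /=.
have [gv|gv] := boolP (0 < g v); last first.
  rewrite mulr0 add0r big_seq big1 => [|p /s0[_ p2]].
    by apply/eqP; rewrite eq_le g0 leNgt gv.
  rewrite (_ : _ < _ = false) ?mulr0 //; apply/negbTE; rewrite -leNgt.
  by move: gv; rewrite -leNgt; lra.
have := hs v; rewrite /g' gv => e.
rewrite mulr1 -[LHS](subrK (g y)) e addrC; congr (_ + _).
by apply: eq_bigr => p _; rewrite ltrBrDr.
Qed.

(** The contribution of one edge to the sweep. If [a] and [b] do not have opposite signs, the layers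
    give at most [a ^+ 2 + b ^+ 2], and the right side is the square of [|a| + |b|]. If they do, the
    layers below both squares cancel, and what remains is at most the difference of the squares,
    which equals the right side. *)
Lemma layer_sum_le (R : realType) (s : seq (R * R)) (a b : R) :
    {in s, forall p, 0 <= p.1 /\ 0 <= p.2} ->
    a ^+ 2 = \sum_(p <- s) p.1 * (p.2 < a ^+ 2)%R%:R ->
    b ^+ 2 = \sum_(p <- s) p.1 * (p.2 < b ^+ 2)%R%:R ->
  \sum_(p <- s) p.1 * `|Num.sg a * (p.2 < a ^+ 2)%R%:R + Num.sg b * (p.2 < b ^+ 2)%R%:R|
    <= `|a + b| * (`|a| + `|b|).
Proof.
move=> s0; wlog ab : a b / a ^+ 2 <= b ^+ 2.
  move=> H ha hb; have [ab|ba] := leP (a ^+ 2) (b ^+ 2); first exact: H.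
  rewrite addrC [`|a| + _]addrC; under eq_bigr do rewrite addrC.
  by apply: H => //; apply: ltW.
move=> ha hb; have [sab|sab] := leP 0 (a * b).
  apply: (@le_trans _ _ (a ^+ 2 + b ^+ 2)).
    rewrite {2}ha {2}hb -big_split big_seq [leRHS]big_seq /=.
    apply: ler_sum => p /s0[p1 p2]; rewrite -mulrDr ler_wpM2l //.
    apply: le_trans (ler_normD _ _) _; rewrite !normrM !normr_nat.
    by apply: lerD; rewrite ler_piMl ?normr_sg ?lern1 ?leq_b1.
  by case: (ger0P a) => a0; case: (ger0P b) => b0; case: (ger0P (a + b)) => c0; nra.
apply: (@le_trans _ _ (b ^+ 2 - a ^+ 2)).
  rewrite {2}ha {2}hb -sumrB big_seq [leRHS]big_seq /=.
  apply: ler_sum => p /s0[p1 p2]; rewrite -mulrBr ler_wpM2l //.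
  have -> : Num.sg b = - Num.sg a.
    by case: (sgrP a) sab => ?; case: (sgrP b) => ?; rewrite ?opprK ?oppr0 //; nra.
  rewrite mulNr -mulrBr normrM.
  have na : `|Num.sg a| <= 1 by rewrite normr_sg lern1 leq_b1.
  apply: (le_trans (ler_piMl _ na)); rewrite // distrC ger0_norm // subr_ge0 ler_nat.
  case: (ltP p.2 (a ^+ 2)) => // pa.
  by rewrite (lt_le_trans pa).
by case: (ger0P a) => a0; case: (ger0P b) => b0; case: (ger0P (a + b)) => c0; nra.
Qed.

Lemma sum_weight_mulD (R : realType) (V : finType) (w : V -> V -> R) (g : V -> R) :
  (forall u v, w u v = w v u) ->
  \sum_u \sum_v w u v * (g u + g v) = 2 * \sum_u deg w u * g u.
Proof.
move=> wC; have e : \sum_u \sum_v w u v * g u = \sum_u deg w u * g u.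
  by apply: eq_bigr => u _; rewrite mulr_suml.
have e' : \sum_u \sum_v w u v * g v = \sum_u deg w u * g u.
  by rewrite exchange_big -e /=; do 2!apply: eq_bigr => ? _; rewrite wC.
rewrite mulr_natl mulr2n -{1}e -e' -big_split; apply: eq_bigr => u _ /=.
by rewrite -big_split; apply: eq_bigr => v _; rewrite mulrDr.
Qed.

(** This expresses the numerator of [1 - phibar] as an l1 energy. The absolute value is the number
    of endpoints in [P :|: Q], lowered by 2 on each ordered pair that crosses between [P] and
    [Q]. *)
Lemma signed_degree_sum (R : realType) (V : finType) (w : V -> V -> R) (P Q : {set V}) :
    (forall u v, w u v = w v u) -> [disjoint P & Q] ->
  \sum_u \sum_v w u v
      * `|((u \in P)%:R - (u \in Q)%:R) + ((v \in P)%:R - (v \in Q)%:R)|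
    = 2 * (vol w (P :|: Q) - 2 * cut w P Q).
Proof.
move=> wC dPQ.
have e (A B : {set V}) : cut w A B = \sum_u \sum_v w u v * ((u \in A) && (v \in B))%:R.
  rewrite /cut big_mkcond; apply: eq_bigr => u _; case: (u \in A); last first.
    by rewrite big1 // => v _; rewrite mulr0.
  by rewrite big_mkcond; apply: eq_bigr => v _; case: (v \in B); rewrite ?mulr1 ?mulr0.
have eC : cut w P Q = cut w Q P.
  by rewrite /cut exchange_big; do 2!apply: eq_bigr => ? _.
have -> : 2 * (vol w (P :|: Q) - 2 * cut w P Q)
  = 2 * vol w (P :|: Q) - 2 * cut w P Q - 2 * cut w Q P by rewrite -eC; ring.
have -> : vol w (P :|: Q) = \sum_u deg w u * (u \in P :|: Q)%:R.
  by rewrite /vol big_mkcond; apply: eq_bigr => u _; case: ifP; rewrite ?mulr1 ?mulr0.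
rewrite -sum_weight_mulD // !e !mulr_sumr -!sumrB; apply: eq_bigr => u _.
rewrite !mulr_sumr -!sumrB; apply: eq_bigr => v _.
have dj x : ~~ ((x \in P) && (x \in Q)).
  by apply/negP => /andP[xP xQ]; have := disjointFr dPQ xP; rewrite xQ.
rewrite !inE; have := dj u; have := dj v.
by case: (u \in P); case: (u \in Q); case: (v \in P); case: (v \in Q) => //= _ _;
  rewrite ?(subr0, sub0r, addr0, add0r, subrr, normr0, normr1, normrN1, normrN, addNr) //=;
  rewrite -?opprD ?normrN ?[`|1 + 1|]ger0_norm ?addr_ge0 //; ring.
Qed.

(** [L] bounds a sum over ordered pairs, hence twice the dual Rayleigh quotient of [psi]. The
    support condition is what later makes the pairs obtained from different functions disjoint. *)
Lemma dual_cheeger (R : realType) (V : finType) (w : V -> V -> R) (psi : V -> R) (L : R) :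
    is_weighted_graph w ->
    0 < \sum_u deg w u * psi u ^+ 2 ->
    \sum_u \sum_v w u v * (psi u + psi v) ^+ 2 <= L * \sum_u deg w u * psi u ^+ 2 ->
  exists P Q : {set V}, [/\ [disjoint P & Q], P :|: Q != set0,
    {in P :|: Q, forall v, psi v != 0},
    0 <= 1 - phibar w P Q <= 1 & (1 - phibar w P Q) ^+ 2 <= L].
Proof.
move=> [w0 wC wD d0] M0 hL; set M := \sum_u deg w u * _ in M0 hL.
have L0 : 0 <= L.
  rewrite -(pmulr_lge0 _ M0); apply: le_trans hL; apply: sumr_ge0 => u _.
  by apply: sumr_ge0 => v _; rewrite mulr_ge0 ?sqr_ge0.
pose K := \sum_u \sum_v w u v * (`|psi u + psi v| * (`|psi u| + `|psi v|)).
have K0 : 0 <= K.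
  by do 2!apply: sumr_ge0 => ? _; rewrite mulr_ge0 ?mulr_ge0 ?addr_ge0.
have hK : K <= 2 * Num.sqrt L * M.
  have KLM : K ^+ 2 <= (L * M) * (4 * M).
    have := @weighted_cauchy_schwarz R (V * V)%type (fun p => w p.1 p.2)
      (fun p => `|psi p.1 + psi p.2|) (fun p => `|psi p.1| + `|psi p.2|) (fun p => w0 _ _).
    rewrite -(pair_bigA _ (fun u v => w u v * (`|psi u + psi v| * (`|psi u| + `|psi v|)))) /=.
    rewrite -(pair_bigA _ (fun u v => w u v * `|psi u + psi v| ^+ 2)) /=.
    rewrite -(pair_bigA _ (fun u v => w u v * (`|psi u| + `|psi v|) ^+ 2)) /=.
    move=> h; apply: (le_trans h).
    apply: ler_pM; try by do 2!apply: sumr_ge0 => ? _; rewrite mulr_ge0 ?sqr_ge0.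
      apply: le_trans hL; apply: ler_sum => u _; apply: ler_sum => v _.
      by rewrite real_normK ?num_real.
    (* One factor 2 comes from [(|x| + |y|)^2 <= 2 (x^2 + y^2)], the other from meeting each vertex
       as first and as second endpoint. *)
    have -> : 4 * M = 2 * (2 * M) by ring.
    rewrite -sum_weight_mulD // mulr_sumr; apply: ler_sum => u _.
    rewrite mulr_sumr; apply: ler_sum => v _; rewrite [leRHS]mulrCA ler_wpM2l //.
    rewrite -(real_normK (num_real (psi u))) -(real_normK (num_real (psi v))).
    have := sqr_ge0 (`|psi u| - `|psi v|); nra.
  rewrite -(@ler_pXn2r _ 2) ?nnegrE ?mulr_ge0 ?sqrtr_ge0 ?(ltW M0) //.
  by apply: le_trans KLM _; rewrite !exprMn sqr_sqrtr // le_eqVlt; apply/orP; left; apply/eqP; ring.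
have [s s0 hs] := @layer_cake _ _ (fun v => psi v ^+ 2) (fun v => sqr_ge0 _).
(* The candidates are the superlevel sets of [psi ^+ 2], split by the sign of [psi]. *)
pose P (t : R) := [set v | (0 < psi v) && (t < psi v ^+ 2)].
pose Q (t : R) := [set v | (psi v < 0) && (t < psi v ^+ 2)].
have dPQ t : [disjoint P t & Q t].
  rewrite -setI_eq0; apply/eqP/setP => v; rewrite !inE.
  by case: (ltgtP (psi v) 0); rewrite ?andbF.
have sgE t v : 0 <= t -> Num.sg (psi v) * (t < psi v ^+ 2)%R%:R = (v \in P t)%:R - (v \in Q t)%:R.
  move=> t0; rewrite !inE; case: (sgrP (psi v)) => /= h; rewrite ?mul0r ?subr0 ?mul1r //.
  by rewrite sub0r mulN1r.
have sbE t v : 0 <= t -> (v \in P t :|: Q t) = (t < psi v ^+ 2).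
  move=> t0; rewrite !inE -andb_orl; case: (ltgtP (psi v) 0) => //= ->.
  by rewrite expr0n /= le_gtF.
pose a p := \sum_u \sum_v w u v * (p.1 * `|Num.sg (psi u) * (p.2 < psi u ^+ 2)%R%:R
                                  + Num.sg (psi v) * (p.2 < psi v ^+ 2)%R%:R|).
pose b p := p.1 * vol w (P p.2 :|: Q p.2).
have sb : \sum_(p <- s) b p = M.
  rewrite /M; under [RHS]eq_bigr do rewrite hs mulr_sumr.
  rewrite exchange_big; apply: eq_big_seq => p /s0[_ p2] /=.
  rewrite /b /vol mulr_sumr big_mkcond; apply: eq_bigr => v _.
  by rewrite sbE //; case: ifP; rewrite ?mulr1 ?mulr0 // mulrC.
(* Over all layers, [b] adds up to [M] and [a] to at most [K], so some threshold is as good as the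
   average. *)
case: (@exists_mediant R _ s a b (2 * Num.sqrt L)).
- by move=> p /s0[p1 p2]; do 2!apply: sumr_ge0 => ? _; rewrite !mulr_ge0.
- move=> p /s0[p1 p2]; rewrite mulr_ge0 //; apply: sumr_ge0 => u _; exact: ltW.
- by rewrite sb.
- rewrite sb; apply: le_trans hK; rewrite exchange_big; apply: ler_sum => u _.
  rewrite exchange_big; apply: ler_sum => v _; rewrite -mulr_sumr ler_wpM2l //.
  exact: layer_sum_le.
move=> [c t] /s0[/= c0 t0] []; rewrite /a /b /= => pos le.
have cp : 0 < c by rewrite lt_neqAle c0 andbT; apply/eqP => e; move: pos; rewrite -e mul0r ltxx.
move: pos; rewrite pmulr_rgt0 // => volp.
have {le} : 2 * (vol w (P t :|: Q t) - 2 * cut w (P t) (Q t))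
    <= 2 * Num.sqrt L * vol w (P t :|: Q t).
  rewrite -(ler_pM2l cp) [leRHS]mulrCA -signed_degree_sum //; apply: le_trans le.
  rewrite mulr_sumr; apply: ler_sum => u _; rewrite mulr_sumr; apply: ler_sum => v _.
  by rewrite !sgE // [leRHS]mulrCA.
have cut0 : 0 <= cut w (P t) (Q t) by do 2!apply: sumr_ge0 => ? _.
have phE : 1 - phibar w (P t) (Q t)
    = (vol w (P t :|: Q t) - 2 * cut w (P t) (Q t)) / vol w (P t :|: Q t).
  by rewrite /phibar mulrBl divff ?gt_eqF.
have dif0 : 0 <= vol w (P t :|: Q t) - 2 * cut w (P t) (Q t).
  rewrite -(@pmulr_rge0 _ 2) // -signed_degree_sum //.
  by do 2!apply: sumr_ge0 => ? _; rewrite mulr_ge0.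
move=> le; exists (P t), (Q t); split=> //.
- by apply/eqP => e; move: volp; rewrite e /vol big_set0 ltxx.
- move=> v; rewrite sbE // => h; apply/eqP => e; move: h.
  by rewrite e expr0n /= le_gtF.
- rewrite phE divr_ge0 ?(ltW volp) //= ler_pdivrMr //; lra.
- have t1 : 1 - phibar w (P t) (Q t) <= Num.sqrt L by rewrite phE ler_pdivrMr //; lra.
  rewrite -[leRHS](sqr_sqrtr L0) ler_pXn2r ?nnegrE ?sqrtr_ge0 //.
  by rewrite phE divr_ge0 ?(ltW volp).
Qed.

(** * Greedy grouping into heavy groups *)

(** Remove elements until the total is at most [c]. An element of mass at least 1/2 is itself a
    solution; removing a lighter one from a total above [c >= 1] leaves more than 1/2. *)
Lemma exists_medium_subset (R : realType) (T : finType) (m : T -> R) (c : R) (S : {set T}) :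
    1 <= c -> (forall t, 0 <= m t <= c) -> 1 / 2 <= \sum_(t in S) m t ->
  exists2 A : {set T}, A \subset S & 1 / 2 <= \sum_(t in A) m t <= c.
Proof.
move=> c1 mc; have [n] := ubnP #|S|; elim: n S => // n IHn S /ltnSE Sn hS.
have [Sc|Sc] := leP (\sum_(t in S) m t) c; first by exists S; rewrite // hS.
have [t tS] : exists t, t \in S.
  by apply/set0Pn; apply/eqP => e; move: Sc; rewrite e big_set0; lra.
have [mt|mt] := leP (1 / 2) (m t).
  by exists [set t]; rewrite ?sub1set // big_set1 mt; case/andP: (mc t).
case: (IHn (S :\ t)) => [||A AS hA].
- by move: Sn; rewrite (cardsD1 t) tS.
- by move: Sc; rewrite (big_setD1 t) //=; lra.
- by exists A => //; apply: subset_trans AS (subsetDl _ _).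
Qed.

(** Each group uses up at most [c], and the last one only needs 1/2 to be left, whence the bound
    [(k - 1) c + 1/2]. *)
Lemma greedy_grouping (R : realType) (T : finType) (m : T -> R) (c : R) (k : nat)
    (S : {set T}) :
    1 <= c -> (forall t, 0 <= m t <= c) ->
    k%:R * c + 1 / 2 - c <= \sum_(t in S) m t ->
  exists g : T -> nat, forall j, (j < k)%N -> 1 / 2 <= \sum_(t in S | g t == j) m t.
Proof.
move=> c1 mc; elim: k S => [|k IHk] S hS; first by exists (fun=> 0%N).
have kc : 0 <= k%:R * c by rewrite mulr_ge0 //; lra.
rewrite -natr1 in hS.
case: (@exists_medium_subset R T m c S) => // [|A AS /andP[A1 A2]]; first by lra.
have sSA : \sum_(t in S) m t = \sum_(t in A) m t + \sum_(t in S :\: A) m t.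
  by rewrite (big_setID A) /= (setIidPr AS).
case: (IHk (S :\: A)) => [|g hg]; first by move: hS; rewrite sSA; lra.
exists (fun t => if t \in A then k else g t) => j.
rewrite ltnS leq_eqVlt => /predU1P[-> | jk].
  apply: le_trans A1 _; rewrite [leRHS]big_mkcondr [leRHS](big_setID A) /= (setIidPr AS).
  rewrite [X in _ <= X + _](eq_bigr m) => [|t ->]; last by rewrite eqxx.
  (* Elements outside [A] that happen to carry the label [k] can only add mass. *)
  by rewrite lerDl; apply: sumr_ge0 => t _; case: ifP => // _; case/andP: (mc t).
apply: le_trans (hg j jk) _; rewrite [leRHS]big_mkcondr [leRHS](big_setID A) /=.
rewrite [leLHS]big_mkcondr /= [X in _ <= _ + X](eq_bigr (fun t => if g t == j then m t else 0)).
  by rewrite lerDr; apply: sumr_ge0 => t _; case: ifP => // _; case/andP: (mc t).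
by move=> t; rewrite inE => /andP[/negbTE-> _].
Qed.

(** * Staircase functions *)

(** [ramp n] is odd and nondecreasing; on the nonnegative half-line it climbs from 0
    to 1 over [n, n+1].  The [stair]s for i < N have disjoint climbing zones and add
    up to the identity, so that squared differences of all of them add up to at
    most one squared difference; an integer value of [stair N Q i] is a plateau. *)
Definition clamp (R : realType) (n : nat) (a : R) : R := Num.max (- n%:R) (Num.min a n%:R).

Definition ramp (R : realType) (n : nat) (a : R) : R := clamp n.+1 a - clamp n a.

Definition stair (R : realType) (N Q i : nat) (a : R) : R :=
  \sum_(q < Q) ramp (q * N + i) a.

Section Stair.
Variable R : realType.
Implicit Types (a b : R) (n N Q i : nat).

Lemma clampP n a : [\/ a <= - n%:R /\ clamp n a = - n%:R,
  - n%:R <= a <= n%:R /\ clamp n a = a | n%:R <= a /\ clamp n a = n%:R].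
Proof.
have n0 : 0 <= n%:R :> R by [].
have [h|h] := leP a (- n%:R).
  by constructor 1; split=> //; rewrite /clamp (min_idPl _) ?(max_idPl _) //; lra.
have [h'|h'] := leP a n%:R.
  by constructor 2; split; [lra|]; rewrite /clamp (min_idPl _) ?(max_idPr _) //; lra.
by constructor 3; split; [lra|]; rewrite /clamp (min_idPr _) ?(max_idPr _) //; lra.
Qed.

Lemma rampN n a : ramp n (- a) = - ramp n a.
Proof.
rewrite /ramp; have n0 : 0 <= n%:R :> R by [].
by case: (clampP n a) (clampP n (- a)) (clampP n.+1 a) (clampP n.+1 (- a)) => [] [? ->];
  case=> [] [? ->]; case=> [] [? ->]; case=> [] [? ->]; move: (@natr1 R n); lra.
Qed.

Lemma ramp_homo n : {homo @ramp R n : a b / a <= b}.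
Proof.
move=> a b ab; rewrite /ramp; have n0 : 0 <= n%:R :> R by [].
by case: (clampP n a) (clampP n b) (clampP n.+1 a) (clampP n.+1 b) => [] [? ->];
  case=> [] [? ->]; case=> [] [? ->]; case=> [] [? ->]; move: (@natr1 R n); lra.
Qed.

Lemma ramp_itv n a : 0 <= a -> 0 <= ramp n a <= 1.
Proof.
move=> a0; rewrite /ramp; have n0 : 0 <= n%:R :> R by [].
by case: (clampP n a) (clampP n.+1 a) => [] [? ->];
  case=> [] [? ->]; move: (@natr1 R n); lra.
Qed.

Lemma ramp_anti n n' a : 0 <= a -> (n <= n')%N -> ramp n' a <= ramp n a.
Proof.
move=> a0; rewrite leq_eqVlt => /predU1P[-> //|]; rewrite -(ler_nat R) => nn'.
have n0 : 0 <= n%:R :> R by []; rewrite /ramp.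
by case: (clampP n a) (clampP n' a) (clampP n.+1 a) (clampP n'.+1 a) => [] [? ->];
  case=> [] [? ->]; case=> [] [? ->]; case=> [] [? ->]; move: (@natr1 R n) (@natr1 R n'); lra.
Qed.

Lemma ramp_int n a : ~~ (n%:R < `|a| < n.+1%:R) -> ramp n a \is a Num.int.
Proof.
wlog a0 : a / 0 <= a.
  move=> H h; have [a0|a0] := leP 0 a; first exact: H.
  by rewrite -[a]opprK rampN rpredN; apply: H; rewrite ?normrN //; lra.
rewrite ger0_norm // negb_and -!leNgt /ramp; have n0 : 0 <= n%:R :> R by [].
move: (@natr1 R n) => e /orP[] h.
  have -> : clamp n.+1 a - clamp n a = 0; last by rewrite rpred0.
  by case: (clampP n a) (clampP n.+1 a) => [] [? ->]; case=> [] [? ->]; lra.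
have -> : clamp n.+1 a - clamp n a = 1; last by rewrite rpred1.
by case: (clampP n a) (clampP n.+1 a) => [] [? ->]; case=> [] [? ->]; lra.
Qed.

Lemma big_block_sum N Q (G : nat -> R) :
  \sum_(i < N) \sum_(q < Q) G (q * N + i)%N = \sum_(n < Q * N) G n.
Proof.
rewrite exchange_big -(big_mkord xpredT G) big_nat_mul big_mkord /=.
apply: eq_bigr => q _; rewrite -[in RHS](add0n (q * N)%N) big_addn mulSn addnK big_mkord.
by apply: eq_bigr => i _; rewrite addnC.
Qed.

Lemma stairN N Q i a : stair N Q i (- a) = - stair N Q i a.
Proof. by rewrite /stair -sumrN; apply: eq_bigr => q _; rewrite rampN. Qed.

Lemma stair_homo N Q i : {homo @stair R N Q i : a b / a <= b}.
Proof. by move=> a b ab; apply: ler_sum => q _; apply: ramp_homo. Qed.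

(** The ramps telescope to [clamp (Q * N) a - clamp 0 a]; the first term is [a] on this range and
    the second is 0. *)
Lemma sum_stair N Q a : `|a| <= (Q * N)%:R -> \sum_(i < N) stair N Q i a = a.
Proof.
move=> ha; rewrite /stair (big_block_sum N Q (fun n => ramp n a)).
rewrite -(big_mkord xpredT (fun n => ramp n a)) telescope_sumr //.
by move: ha; case: (clampP (Q * N) a) (clampP 0 a) => [] [? ->]; case=> [] [? ->];
  case: (ger0P a) => ?; lra.
Qed.

(** By monotonicity the increments all have the same sign, and they add up to [a - b]; so their
    squares add up to at most its square. *)
Lemma sum_sqr_stair_le N Q a b : `|a| <= (Q * N)%:R -> `|b| <= (Q * N)%:R ->
  \sum_(i < N) (stair N Q i a - stair N Q i b) ^+ 2 <= (a - b) ^+ 2.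
Proof.
wlog ab : a b / b <= a.
  move=> H ha hb; have [ab|ba] := leP b a; first exact: H.
  rewrite -[leRHS]sqrrN opprB; under eq_bigr do rewrite -sqrrN opprB.
  by apply: H => //; apply: ltW.
move=> ha hb; pose d (i : 'I_N) := stair N Q i a - stair N Q i b.
have d0 (i : 'I_N) : 0 <= d i by rewrite subr_ge0 stair_homo.
have e : \sum_i d i = a - b by rewrite sumrB !sum_stair.
rewrite -e expr2 mulr_suml; apply: ler_sum => i _; rewrite -/(d i) expr2 ler_wpM2l //.
by rewrite (bigD1 i) //= lerDl sumr_ge0.
Qed.

(** The climbing zones interleave: ramp [q + 1] of stair [i] starts no earlier than ramp [q] of
    stair [i'], and the unmatched first ramp is at most 1. *)
Lemma stair_le_add1 N Q i i' a : (i < N)%N -> (i' < N)%N -> 0 <= a ->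
  stair N Q i a <= stair N Q i' a + 1.
Proof.
move=> iN i'N a0; rewrite /stair; case: Q => [|Q]; first by rewrite !big_ord0 add0r.
rewrite big_ord_recl [X in _ <= X + _]big_ord_recr /= addrC.
have /andP[r0 _] := ramp_itv (Q * N + i') a0; have /andP[_ r1] := ramp_itv (0 * N + i) a0.
have : \sum_(q < Q) ramp (lift ord0 q * N + i) a <= \sum_(q < Q) ramp (q * N + i') a.
  by apply: ler_sum => q _; apply: ramp_anti => //=; rewrite /bump /=; nia.
by rewrite /=; lra.
Qed.

(** Compare [N] copies of one stair with the sum of all stairs, which is [a], term by term. *)
Lemma stair_approx N Q i a : (i < N)%N -> `|a| <= (Q * N)%:R ->
  `|N%:R * stair N Q i a - a| <= N%:R.
Proof.
wlog a0 : a / 0 <= a.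
  move=> H h ha; have [a0|a0] := leP 0 a; first exact: H.
  have := H (- a); rewrite stairN mulrN -opprD !normrN; apply=> //; lra.
move=> iN /sum_stair e.
have c x : \sum_(j < N) (x : R) = N%:R * x by rewrite sumr_const card_ord mulr_natl.
rewrite ler_norml; apply/andP; split.
  suff : a <= N%:R * (stair N Q i a + 1) by lra.
  by rewrite -{1}e -c; apply: ler_sum => j _; apply: stair_le_add1.
suff : N%:R * stair N Q i a <= a + N%:R * 1 by lra.
by rewrite -{2}e -!c -big_split; apply: ler_sum => j _; apply: stair_le_add1.
Qed.

Lemma sum_ramp_window M a : \sum_(n < M) (n%:R < a < n.+1%:R)%R%:R <= ((0 < a < M%:R)%R%:R : R).
Proof.
elim: M => [|M IHM]; first by rewrite big_ord0.
rewrite big_ord_recr /=; apply: le_trans (lerD IHM (lexx _)) _.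
rewrite -natrD ler_nat; have M0 : 0 <= M%:R :> R by []; move: (@natr1 R M) => e.
case: (ltP 0 a) => h1; case: (ltP a M%:R) => h2; case: (ltP M%:R a) => h3;
  case: (ltP a M.+1%:R) => h4 //=; lra.
Qed.

(** [|a|] lies in at most one open climbing zone, so at most one stair is off its plateaus. *)
Lemma sum_stair_nonint_le N Q a :
  \sum_(i < N) (stair N Q i a \isn't a Num.int)%:R <= 1 :> R.
Proof.
apply: (@le_trans _ _ (\sum_(n < Q * N) (n%:R < `|a| < n.+1%:R)%R%:R)); last first.
  by apply: le_trans (sum_ramp_window _ _) _; rewrite lern1 leq_b1.
rewrite -(big_block_sum N Q (fun n => (n%:R < `|a| < n.+1%:R)%R%:R)); apply: ler_sum => i _.
have [h|] := boolP (stair N Q i a \is a Num.int); first by apply: sumr_ge0.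
apply: contraR => /= h; apply: rpred_sum => q _; apply: ramp_int.
apply: contra h => h; rewrite (bigD1 q) //= h lerDl; exact: sumr_ge0.
Qed.

End Stair.

(** * Cells and cutoffs *)

(* Rounding away from zero at half-integers keeps [rnd] odd. *)
Definition rnd (R : realType) (h : R) : int := sgz h * Num.floor (`|h| + 1 / 2).

(** A periodic tent, vanishing at the half-integers, where [rnd] jumps; hence it is continuous
    although [rnd] is not. *)
Definition plateau (R : realType) (h : R) : R := 1 - 2 * `|h - (rnd h)%:~R|.

Section Rounding.
Variable R : realType.
Implicit Types a b h : R.

Lemma rndN h : rnd (- h) = - rnd h.
Proof. by rewrite /rnd sgzN normrN mulNr. Qed.

Lemma rnd_dist h : `|h - (rnd h)%:~R| <= 1 / 2.
Proof.
rewrite /rnd intrM -sgrEz; have /andP[] := floor_itv (`|h| + 1 / 2).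
rewrite intrD mulr1z; set m : R := (Num.floor _)%:~R; case: (sgrP h) => [->|h0|h0].
- by rewrite mul0r subrr normr0; lra.
- by rewrite mul1r ler_norml; lra.
- by rewrite mulN1r ler_norml; lra.
Qed.

Lemma rnd_close a b : rnd a = rnd b -> `|a - b| <= 1.
Proof.
move=> e; have := rnd_dist a; have := rnd_dist b; rewrite e !ler_norml => ? ?; lra.
Qed.

Lemma plateau_itv h : 0 <= plateau h <= 1.
Proof. by rewrite /plateau; have := rnd_dist h; have := normr_ge0 (h - (rnd h)%:~R); lra. Qed.

Lemma plateauN h : plateau (- h) = plateau h.
Proof. by rewrite /plateau rndN mulrNz -opprD normrN. Qed.

Lemma plateau_int h : h \is a Num.int -> plateau h = 1.
Proof.
move=> hi; rewrite /plateau.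
have [->|ne] := eqVneq (h - (rnd h)%:~R) 0; first by rewrite normr0; lra.
have := norm_intr_ge1 _ ne; rewrite rpredB ?intr_int // => /(_ isT).
by have := rnd_dist h; lra.
Qed.

(** A plateau is at most twice the signed distance to either wall of its cell, and the walls
    [rnd a + 1/2 <= rnd b - 1/2] separate the two cells. *)
Lemma plateau_sep a b : rnd a != rnd b -> plateau a + plateau b <= 2 * `|a - b|.
Proof.
wlog ab : a b / rnd a < rnd b.
  move=> H ne; case: (ltgtP (rnd a) (rnd b)) ne => // h _; first by apply: H; rewrite // lt_eqF.
  by rewrite addrC distrC; apply: H; rewrite // lt_eqF.
move=> _; have : (rnd a)%:~R + 1 <= (rnd b)%:~R :> R.
  by rewrite -[X in _ + X](mulr1z 1) -intrD ler_int; lia.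
rewrite /plateau; have := ler_norm (a - (rnd a)%:~R); have := ler_norm ((rnd b)%:~R - b).
by rewrite distrC; have := ler_norm (b - a); rewrite [`|b - a|]distrC; lra.
Qed.

Lemma plateau_lip a b : `|plateau a - plateau b| <= 2 * `|a - b|.
Proof.
have [e|/plateau_sep] := eqVneq (rnd a) (rnd b); last first.
  by have := plateau_itv a; have := plateau_itv b; rewrite ler_norml; lra.
rewrite /plateau e; set m : R := _%:~R.
have -> : 1 - 2 * `|a - m| - (1 - 2 * `|b - m|) = 2 * (`|b - m| - `|a - m|) by ring.
rewrite normrM ger0_norm // ler_wpM2l // distrC; apply: le_trans (ler_dist_dist _ _) _.
by rewrite (_ : a - m - (b - m) = a - b) //; ring.
Qed.

End Rounding.

Section Cutoff.
Variables (R : realType) (V : finType) (k : nat) (h : V -> 'I_k -> R).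

Definition cutoff (u : V) : R := \big[Num.min/1]_(l < k) plateau (h u l).

(** Antipodal cells are glued because the dual energy is small on an edge whose endpoints are mapped
    to nearly opposite vectors. *)
Definition same_cell (u v : V) : bool :=
  [forall l, rnd (h u l) == rnd (h v l)] || [forall l, rnd (h u l) == - rnd (h v l)].

(** A class is labelled by its own set of members, so that labels range over the finite type
    [{set V}]; sets that are no class carry no mass. *)
Definition cluster (u : V) : {set V} := [set v | same_cell u v].

Lemma same_cell_trans : transitive same_cell.
Proof.
move=> v u x /orP[]/forallP uv /orP[]/forallP vx; apply/orP.
- by left; apply/forallP => l; rewrite (eqP (uv l)).
- by right; apply/forallP => l; rewrite (eqP (uv l)).
- by right; apply/forallP => l; rewrite (eqP (uv l)) (eqP (vx l)).
- by left; apply/forallP => l; rewrite (eqP (uv l)) (eqP (vx l)) opprK.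
Qed.

Lemma same_cell_sym : symmetric same_cell.
Proof.
suff H u v : same_cell u v -> same_cell v u by move=> u v; apply/idP/idP; apply: H.
move=> /orP[]/forallP uv; apply/orP; [left|right]; apply/forallP => l.
  by rewrite (eqP (uv l)).
by rewrite (eqP (uv l)) opprK.
Qed.

Lemma mem_cluster u : u \in cluster u.
Proof. by rewrite inE; apply/orP; left; apply/forallP. Qed.

Lemma eq_clusterE u v : (cluster u == cluster v) = same_cell u v.
Proof.
apply/eqP/idP => [e|uv].
  by have := mem_cluster v; rewrite -e inE.
apply/setP => x; rewrite !inE; apply/idP/idP; apply: same_cell_trans => //.
by rewrite same_cell_sym.
Qed.

Lemma cutoff_itv u : 0 <= cutoff u <= 1.
Proof.
rewrite /cutoff; elim/big_rec: _ => [|l x _ /andP[x0 x1]]; first by rewrite ler01 lexx.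
by have /andP[p0 p1] := plateau_itv (h u l); rewrite le_min ge_min p0 x0 p1.
Qed.

Lemma cutoff_int u : (forall l, h u l \is a Num.int) -> cutoff u = 1.
Proof.
by move=> hi; rewrite /cutoff; elim/big_rec: _ => // l x _ ->; rewrite plateau_int // minxx.
Qed.

(** Plateaus are even, so [h u] may be compared with [- h v]. The factor 4 is the square of their
    Lipschitz constant, and a minimum is nonexpansive. *)
Lemma cutoff_lip u v :
  (cutoff u - cutoff v) ^+ 2 <= 4 * \sum_l (h u l + h v l) ^+ 2.
Proof.
rewrite /cutoff mulr_sumr; elim/big_rec3: _ => [|l s y x _ ih]; first by rewrite subrr expr0n.
have := plateau_lip (h u l) (- h v l); rewrite plateauN opprK.
set a := plateau _; set b := plateau _; set d := h u l + h v l => lip.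
have {lip} : (a - b) ^+ 2 <= 4 * d ^+ 2.
  rewrite -[(a - b) ^+ 2]real_normK ?num_real // -[d ^+ 2]real_normK ?num_real //.
  by have := normr_ge0 (a - b); nra.
have := sqr_ge0 d; have := sqr_ge0 (x - y).
have [m|m] : (Num.min a x - Num.min b y) ^+ 2 <= (a - b) ^+ 2
    \/ (Num.min a x - Num.min b y) ^+ 2 <= (x - y) ^+ 2; [|lra|lra].
case: (leP a x) => h1; case: (leP b y) => h2; [by left| | |by right].
  by have [h3|h3] := leP a y; [left|right]; nra.
by have [h3|h3] := leP x b; [right|left]; nra.
Qed.

(** In different clusters, [h u] and [- h v] lie in different cells, so a wall separates them in
    some coordinate. *)
Lemma cutoff_sep u v : cluster u != cluster v ->
  cutoff u ^+ 2 <= 4 * \sum_l (h u l + h v l) ^+ 2.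
Proof.
rewrite eq_clusterE negb_or => /andP[_ /forallPn[l]]; rewrite -rndN => /plateau_sep.
rewrite plateauN opprK => sep.
have : cutoff u <= plateau (h u l) by apply: bigmin_le.
have /andP[c0 _] := cutoff_itv u; have /andP[p0 _] := plateau_itv (h v l).
move=> cl; have {}cl : cutoff u <= 2 * `|h u l + h v l| by lra.
rewrite (bigD1 l) //= mulrDr -[(h u l + _) ^+ 2]real_normK ?num_real //.
have : 0 <= \sum_(i < k | i != l) (h u i + h v i) ^+ 2 by apply: sumr_ge0 => i _; apply: sqr_ge0.
by nra.
Qed.

(** A product rule. With both ends in group [j], split off [cutoff u * (f l u + f l v)] and bound
    the rest by [cutoff_lip]. With one end in the group, the clusters differ and [cutoff_sep] makes
    the surviving cutoff small. *)
Lemma localized_edge_le (f : 'I_k -> V -> R) (g : V -> nat) (j : nat) (u v : V) :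
    (forall x y, cluster x = cluster y -> g x = g y) ->
  \sum_l ((g u == j)%:R * cutoff u * f l u + (g v == j)%:R * cutoff v * f l v) ^+ 2
    <= 2 * sqnorm_sum f u v
       + 8 * ((\sum_l (h u l + h v l) ^+ 2) * (sqnorm f u + sqnorm f v)).
Proof.
move=> hg; set D := \sum_l (h u l + h v l) ^+ 2.
have D0 : 0 <= D by apply: sumr_ge0 => l _; apply: sqr_ge0.
have s0 x : 0 <= sqnorm f x by apply: sumr_ge0 => l _; apply: sqr_ge0.
have ss0 : 0 <= sqnorm_sum f u v by apply: sumr_ge0 => l _; apply: sqr_ge0.
have Dp x : 0 <= D * sqnorm f x by rewrite mulr_ge0.
have /andP[u0 u1] := cutoff_itv u; have /andP[v0 v1] := cutoff_itv v.
have [gu|gu] := eqVneq (g u) j; have [gv|gv] := eqVneq (g v) j.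
- under eq_bigr do rewrite !mul1r.
  apply: (@le_trans _ _ (2 * sqnorm_sum f u v + 2 * ((cutoff v - cutoff u) ^+ 2 * sqnorm f v))).
    rewrite /sqnorm_sum /sqnorm !mulr_sumr -big_split; apply: ler_sum => l _ /=.
    have := sqr_ge0 (cutoff u * (f l u + f l v) - (cutoff v - cutoff u) * f l v).
    have : cutoff u ^+ 2 * (f l u + f l v) ^+ 2 <= (f l u + f l v) ^+ 2.
      by rewrite ler_piMl ?sqr_ge0 // expr_le1.
    by lra.
  have := cutoff_lip u v; rewrite -/D -sqrrN opprB => lip.
  have := ler_wpM2r (s0 v) lip; have := Dp u; lra.
- have sep : cutoff u ^+ 2 <= 4 * D.
    by apply: cutoff_sep; apply: contra gv => /eqP/hg <-; apply/eqP.
  under eq_bigr do rewrite mul1r !mul0r addr0 exprMn.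
  rewrite -mulr_sumr -/(sqnorm f u).
  have := ler_wpM2r (s0 u) sep; have := Dp v; have := Dp u; lra.
- have sep : cutoff v ^+ 2 <= 4 * D.
    rewrite /D; under eq_bigr do rewrite addrC.
    by apply: cutoff_sep; apply: contra gu => /eqP/hg <-; apply/eqP.
  under eq_bigr do rewrite mul1r !mul0r add0r exprMn.
  rewrite -mulr_sumr -/(sqnorm f v).
  have := ler_wpM2r (s0 v) sep; have := Dp v; have := Dp u; lra.
- rewrite big1 => [|l _]; last by rewrite !mul0r addr0 expr0n.
  by have := Dp v; have := Dp u; lra.
Qed.

End Cutoff.

(** * Spreading of the isotropic embedding *)

Lemma exists_two_markov (R : realType) (N : nat) (x y : 'I_N -> R) (X Y : R) :
    (0 < N)%N -> 0 < X -> (forall i, 0 <= x i) -> (forall i, 0 <= y i) ->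
    \sum_i x i <= X -> \sum_i y i <= Y ->
  exists i, N%:R * x i <= 2 * X /\ N%:R * y i <= 2 * Y.
Proof.
move=> N0 X0 x0 y0 sx sy; have NR : 0 < N%:R :> R by rewrite ltr0n.
(* Positivity of b i encodes the bound on x i, so one mediant choice yields both. *)
pose b i := Num.max 0 (1 - N%:R * x i / (2 * X)).
have bN : N%:R / 2 <= \sum_i b i.
  apply: (@le_trans _ _ (\sum_(i < N) (1 - N%:R * x i / (2 * X)))); last first.
    by apply: ler_sum => i _; rewrite le_max lexx orbT.
  rewrite sumrB -mulr_suml -mulr_sumr sumr_const card_ord.
  suff : N%:R * (\sum_i x i) / (2 * X) <= N%:R / 2 by lra.
  rewrite ler_pdivrMr; last by lra.
  have -> : N%:R / 2 * (2 * X) = N%:R * X :> R by field.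
  by rewrite ler_pM2l.
have Y0 : 0 <= Y by apply: le_trans sy; apply: sumr_ge0.
(* The [b i] add up to at least [N / 2], whence the ratio [Y / (N / 2)]; [b i <= 1] then turns it
   into a bound on [y i]. *)
have [||||i _ [bi yi]] := @exists_mediant R _ (index_enum 'I_N) y b (2 * Y / N%:R).
- by move=> i _.
- by move=> i _; rewrite le_max lexx.
- by apply: lt_le_trans bN; rewrite divr_gt0.
- apply: le_trans sy _; apply: le_trans (ler_wpM2l _ bN).
    by rewrite le_eqVlt; apply/orP; left; apply/eqP; field; rewrite gt_eqF.
  by rewrite divr_ge0 ?mulr_ge0.
have xi : 0 <= N%:R * x i / (2 * X) by rewrite divr_ge0 ?mulr_ge0 // ltW.
have b1 : b i <= 1 by rewrite ge_max ler01 /=; lra.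
exists i; split.
  move: bi; rewrite lt_max ltxx /= subr_gt0 ltr_pdivrMr ?mulr_gt0 // mul1r; exact: ltW.
rewrite mulrC -ler_pdivlMr //; apply: le_trans yi _.
by rewrite ler_piMr // divr_ge0 ?mulr_ge0.
Qed.

(** With [t] the inner product, the squared distance is [2 - 2 t], and [t ^+ 2 >= 2 t - 1]. *)
Lemma unit_projection_ge (R : realType) (I : finType) (x y : I -> R) (d : R) :
    \sum_l x l ^+ 2 = 1 -> \sum_l y l ^+ 2 = 1 -> \sum_l (x l - y l) ^+ 2 <= d ->
  1 - d <= (\sum_l y l * x l) ^+ 2.
Proof.
move=> hx hy hd; have : \sum_l (x l - y l) ^+ 2 = 2 - 2 * \sum_l y l * x l.
  have e : 2 = \sum_l x l ^+ 2 + \sum_l y l ^+ 2 :> R by rewrite hx hy.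
  rewrite [X in _ = X - _]e.
  by rewrite mulr_sumr -big_split -sumrB; apply: eq_bigr => l _ /=; ring.
by have := sqr_ge0 (\sum_l y l * x l - 1); lra.
Qed.

Section Embedding.
Variables (R : realType) (V : finType) (w : V -> V -> R) (k : nat) (f : 'I_k -> V -> R).

(* When F u = 0 this is 0, because x / 0 = 0. *)
Definition direction (u : V) (l : 'I_k) : R := f l u / Num.sqrt (sqnorm f u).

Lemma sqnorm_ge0 u : 0 <= sqnorm f u.
Proof. by apply: sumr_ge0 => l _; apply: sqr_ge0. Qed.

Lemma directionE u l : f l u = Num.sqrt (sqnorm f u) * direction u l.
Proof.
rewrite /direction mulrC; have [s0|s0] := eqVneq (sqnorm f u) 0; last first.
  by rewrite divfK // sqrtr_eq0 -ltNge lt_neqAle eq_sym s0 sqnorm_ge0.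
rewrite s0 sqrtr0 mulr0; apply/eqP; rewrite -(sqrf_eq0 (f l u)) eq_le sqr_ge0 andbT -s0.
by rewrite /sqnorm (bigD1 l) //= lerDl; apply: sumr_ge0 => i _; apply: sqr_ge0.
Qed.

Lemma direction_unit u : sqnorm f u != 0 -> \sum_l direction u l ^+ 2 = 1.
Proof.
move=> s0; under eq_bigr do rewrite /direction expr_div_n sqr_sqrtr ?sqnorm_ge0 //.
by rewrite -mulr_suml divff.
Qed.

Lemma direction0 u l : sqnorm f u = 0 -> direction u l = 0.
Proof. by move=> s0; rewrite /direction s0 sqrtr0 invr0 mulr0. Qed.

Lemma direction_le1 u l : `|direction u l| <= 1.
Proof.
have [s0|s0] := eqVneq (sqnorm f u) 0; first by rewrite direction0 // normr0.
rewrite -(@ler_pXn2r _ 2) ?nnegrE // expr1n real_normK ?num_real // -(direction_unit s0).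
by rewrite (bigD1 l) //= lerDl; apply: sumr_ge0 => i _; apply: sqr_ge0.
Qed.

(** The Lipschitz bound for radial projection, applied to [F u] and [- F v]: it converts distances
    of directions into edge energy. *)
Lemma sqnorm_mul_direction_le u v :
  sqnorm f u * \sum_l (direction u l + direction v l) ^+ 2 <= 4 * sqnorm_sum f u v.
Proof.
have ss0 : 0 <= sqnorm_sum f u v by apply: sumr_ge0 => l _; apply: sqr_ge0.
set a := Num.sqrt (sqnorm f u); set b := Num.sqrt (sqnorm f v).
have a0 : 0 <= a by apply: sqrtr_ge0.
have b0 : 0 <= b by apply: sqrtr_ge0.
have aE : sqnorm f u = a ^+ 2 by rewrite sqr_sqrtr // sqnorm_ge0.
have bE : sqnorm f v = b ^+ 2 by rewrite sqr_sqrtr // sqnorm_ge0.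
have [u0|u0] := eqVneq (sqnorm f u) 0; first by rewrite u0 mul0r mulr_ge0.
have [v0|v0] := eqVneq (sqnorm f v) 0.
  have -> : sqnorm_sum f u v = sqnorm f u.
    by apply: eq_bigr => l _; rewrite [f l v]directionE v0 sqrtr0 mul0r addr0.
  under eq_bigr do rewrite (direction0 _ v0) addr0.
  by rewrite direction_unit // mulr1; have := sqnorm_ge0 u; lra.
pose c := \sum_l direction u l * direction v l.
have e1 : \sum_l (direction u l + direction v l) ^+ 2 = 2 + 2 * c.
  have e : 2 = \sum_l direction u l ^+ 2 + \sum_l direction v l ^+ 2 :> R.
    by rewrite !direction_unit.
  rewrite [X in _ = X + _]e.
  by rewrite mulr_sumr -!big_split; apply: eq_bigr => l _ /=; ring.
have e2 : sqnorm_sum f u v = a ^+ 2 + b ^+ 2 + 2 * (a * b * c).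
  have ea : a ^+ 2 = a ^+ 2 * \sum_l direction u l ^+ 2 by rewrite direction_unit ?mulr1.
  have eb : b ^+ 2 = b ^+ 2 * \sum_l direction v l ^+ 2 by rewrite direction_unit ?mulr1.
  rewrite ea eb !mulr_sumr -!big_split; apply: eq_bigr => l _ /=.
  by rewrite [f l u]directionE [f l v]directionE -/a -/b; ring.
have c1 : -1 <= c.
  have : 0 <= 2 + 2 * c by rewrite -e1; apply: sumr_ge0 => l _; apply: sqr_ge0.
  by lra.
have c2 : c <= 1.
  have : 0 <= \sum_l (direction u l - direction v l) ^+ 2.
    by apply: sumr_ge0 => l _; apply: sqr_ge0.
  have -> : \sum_l (direction u l - direction v l) ^+ 2 = 2 - 2 * c.
    have e : 2 = \sum_l direction u l ^+ 2 + \sum_l direction v l ^+ 2 :> R.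
      by rewrite !direction_unit.
    rewrite [X in _ = X - _]e.
    by rewrite mulr_sumr -!big_split -sumrB; apply: eq_bigr => l _ /=; ring.
  by lra.
rewrite e1 e2 aE; have [c0|c0] := leP 0 c.
  have : 0 <= a * b * c by rewrite !mulr_ge0.
  by have := sqr_ge0 b; have := sqr_ge0 a; nra.
(* For [c < 0], write [a^2 + b^2 + 2 a b c = (b + a c)^2 + a^2 (1 + c) (1 - c)] and use
   [1 - c >= 1]. *)
have : 0 <= (b + a * c) ^+ 2 by apply: sqr_ge0.
have : 0 <= a ^+ 2 * (1 + c) * (- c) by rewrite !mulr_ge0 ?sqr_ge0 //; lra.
have : 0 <= a ^+ 2 * (1 + c) by rewrite !mulr_ge0 ?sqr_ge0 //; lra.
by lra.
Qed.

Hypothesis wG : is_weighted_graph w.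
Hypothesis fO : orthonormal_mu w f.

Lemma sum_deg_sqnorm : \sum_u deg w u * sqnorm f u = k%:R.
Proof.
under eq_bigr do rewrite mulr_sumr.
rewrite exchange_big /= -[k in RHS]card_ord -sumr_const; apply: eq_bigr => l _.
transitivity (inner_mu w (f l) (f l)); last by rewrite fO eqxx.
by apply: eq_bigr => u _; rewrite expr2 mulrA.
Qed.

Lemma isotropy (y : 'I_k -> R) :
  \sum_u deg w u * (\sum_l y l * f l u) ^+ 2 = \sum_l y l ^+ 2.
Proof.
transitivity (\sum_u \sum_l \sum_m y l * y m * (deg w u * f l u * f m u)).
  apply: eq_bigr => u _; rewrite expr2 mulr_suml mulr_sumr; apply: eq_bigr => l _.
  by rewrite !mulr_sumr; apply: eq_bigr => m _; ring.
rewrite exchange_big; apply: eq_bigr => l _ /=; rewrite exchange_big (bigD1 l) //=.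
rewrite -mulr_sumr -/(inner_mu _ _ _) (fO l l) eqxx mulr1 big1 ?addr0 ?expr2 // => m ml.
by rewrite -mulr_sumr -/(inner_mu _ _ _) (fO l m) eq_sym (negbTE ml) mulr0.
Qed.

(** By isotropy the squared components along the unit vector [y] have total mass 1, and each vertex
    of [S] contributes at least the share [1 - d] of its own mass. *)
Lemma cap_mass_le (S : {set V}) (y : 'I_k -> R) (d : R) :
    \sum_l y l ^+ 2 = 1 ->
    {in S, forall v, (1 - d) * sqnorm f v <= (\sum_l y l * f l v) ^+ 2} ->
  (1 - d) * \sum_(v in S) deg w v * sqnorm f v <= 1.
Proof.
case: wG => w0 _ _ d0 hy hS; rewrite -[leRHS]hy -isotropy mulr_sumr.
rewrite [leRHS](bigID [in S]) /= -[leLHS]addr0 lerD //.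
  by apply: ler_sum => v vS; rewrite mulrCA ler_wpM2l ?hS // ltW.
by apply: sumr_ge0 => v _; rewrite mulr_ge0 ?sqr_ge0 // ltW.
Qed.

End Embedding.

(** * Translated grids on the sphere of directions *)

Lemma stair_close (R : realType) (N Q i : nat) (a b : R) :
    (i < N)%N -> `|a| <= (Q * N)%:R -> `|b| <= (Q * N)%:R ->
    `|stair N Q i a - stair N Q i b| <= 1 ->
  `|a - b| <= 3 * N%:R.
Proof.
move=> iN ha hb hab; have N0 : 0 <= N%:R :> R by [].
have := stair_approx iN ha; have := stair_approx iN hb.
have : `|N%:R * stair N Q i a - N%:R * stair N Q i b| <= N%:R.
  by rewrite -mulrBr normrM ger0_norm // ler_piMr.
by rewrite !ler_norml; lra.
Qed.

Section Shift.
Variables (R : realType) (V : finType) (k : nat) (f : 'I_k -> V -> R) (N Q : nat).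

(** The index [i] selects the translate. Scaling by [Q * N] sends coordinates of directions, which
    lie in [-1, 1], into the range where the stairs add up to the identity. *)
Definition shifted (i : nat) (u : V) (l : 'I_k) : R :=
  stair N Q i ((Q * N)%:R * direction f u l).

Lemma scaled_direction_le u l : `|(Q * N)%:R * direction f u l| <= (Q * N)%:R.
Proof. by rewrite normrM ger0_norm // ler_piMr // direction_le1. Qed.

(** All [N] translates together cost no more than one copy scaled by [Q * N]; on average this is a
    factor [Q^2 N]. *)
Lemma sum_shifted_energy_le u v :
  \sum_(i < N) \sum_l (shifted i u l + shifted i v l) ^+ 2
    <= (Q * N)%:R ^+ 2 * \sum_l (direction f u l + direction f v l) ^+ 2.
Proof.
rewrite exchange_big mulr_sumr; apply: ler_sum => l _ /=.
rewrite -exprMn mulrDr -[_ * direction f v l]opprK.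
have nv := scaled_direction_le v l; rewrite -normrN in nv.
apply: le_trans (sum_sqr_stair_le (scaled_direction_le u l) nv).
by apply: ler_sum => i _; rewrite stairN opprK.
Qed.

(** Each of the [k] coordinates is off a plateau for at most one translate, and a translate with all
    coordinates on plateaus loses nothing. *)
Lemma sum_cutoff_loss_le u :
  \sum_(i < N) (1 - cutoff (shifted i) u ^+ 2) <= k%:R.
Proof.
apply: (@le_trans _ _ (\sum_(i < N) \sum_(l < k) (shifted i u l \isn't a Num.int)%:R)).
  apply: ler_sum => i _; have /andP[c0 c1] := cutoff_itv (shifted i) u.
  have [/forallP h|/forallPn[l hl]] := boolP [forall l, shifted i u l \is a Num.int].
    by rewrite cutoff_int // expr1n subrr; apply: sumr_ge0.
  apply: (@le_trans _ _ 1); first by rewrite gerBl sqr_ge0.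
  by rewrite (bigD1 l) //= hl lerDl sumr_ge0.
rewrite exchange_big -[k in leRHS]card_ord -sumr_const; apply: ler_sum => l _.
exact: sum_stair_nonint_le.
Qed.

Lemma cluster_mass_le (w : V -> V -> R) (i : nat) (t : {set V}) :
    is_weighted_graph w -> orthonormal_mu w f -> (0 < k)%N -> Q = (6 * k)%N -> (i < N)%N ->
  \sum_(u | cluster (shifted i) u == t) deg w u * sqnorm f u <= 4 * k%:R / (4 * k%:R - 1).
Proof.
move=> wG fO k0 QE iN; have k1 : 1 <= k%:R :> R by rewrite ler1n.
(* Any member with nonzero image can serve as the centre of the cap; without one the mass is 0. *)
have [u0|none] := pickP [pred u | (cluster (shifted i) u == t) && (sqnorm f u != 0)]; last first.
  rewrite big1 => [|u ut]; first by rewrite divr_ge0 //; lra.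
  by have := none u; rewrite /= ut /= => /negbFE/eqP->; rewrite mulr0.
move=> /= /andP[u0t su0].
have [Q0 N0] : 0 < Q%:R :> R /\ 0 < N%:R :> R.
  by rewrite !ltr0n QE; split; [rewrite muln_gt0 k0 | apply: leq_ltn_trans iN].
rewrite ler_pdivlMr; last by lra.
have /(_ [set u | cluster (shifted i) u == t] (direction f u0) (1 / (4 * k%:R))) :=
  cap_mass_le wG fO; rewrite direction_unit //.
under [X in (1 - _) * X]eq_bigl do rewrite inE.
set m := \sum_(u | _) _ => H; suff hm : (1 - 1 / (4 * k%:R)) * m <= 1.
  have := ler_wpM2l (_ : 0 <= 4 * k%:R) hm.
  have -> : 4 * k%:R * ((1 - 1 / (4 * k%:R)) * m) = m * (4 * k%:R - 1) :> R.
    by field; rewrite pnatr_eq0 -lt0n.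
  by rewrite mulr1; apply; lra.
apply: H => // v; rewrite inE -(eqP u0t) eq_clusterE => uv.
have [sv|sv] := eqVneq (sqnorm f v) 0; first by rewrite sv mulr0 sqr_ge0.
have -> : (\sum_l direction f u0 l * f l v) ^+ 2
    = (\sum_l direction f u0 l * direction f v l) ^+ 2 * sqnorm f v.
  rewrite -[sqnorm f v in RHS]sqr_sqrtr ?sqnorm_ge0 // -exprMn mulr_suml.
  by congr (_ ^+ 2); apply: eq_bigr => l _; rewrite [f l v]directionE; ring.
apply: ler_wpM2r; first exact: sqnorm_ge0.
(* [Q = 6k] makes each coordinate difference at most [3 / (6k) = 1 / (2k)]; over [k] coordinates the
   squares add up to at most [1 / (4k)]. *)
have small (x y : R) : `|(Q * N)%:R * x - (Q * N)%:R * y| <= 3 * N%:R ->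
    (x - y) ^+ 2 <= 1 / (4 * k%:R * k%:R).
  rewrite -mulrBr normrM ger0_norm // natrM => h.
  have {}h : 2 * k%:R * `|x - y| <= 1.
    have : N%:R * (Q%:R * `|x - y|) <= N%:R * 3 by rewrite mulrA [N%:R * Q%:R]mulrC; lra.
    by rewrite ler_pM2l // QE natrM; lra.
  rewrite ler_pdivlMr; last by rewrite !mulr_gt0 // ltr0n.
  rewrite -[(x - y) ^+ 2]real_normK ?num_real //.
  have : 0 <= 2 * k%:R * `|x - y| by rewrite !mulr_ge0.
  by nra.
have sumc : \sum_(l < k) 1 / (4 * k%:R * k%:R) = 1 / (4 * k%:R) :> R.
  rewrite sumr_const card_ord -mulr_natl; field; by rewrite pnatr_eq0 -lt0n.
case/orP: uv => /forallP uv.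
  apply: unit_projection_ge; rewrite ?direction_unit // -sumc.
  apply: ler_sum => l _; apply: small.
  apply: (@stair_close _ N Q i); rewrite ?scaled_direction_le //.
  exact: rnd_close (eqP (uv l)).
(* In the antipodal cell, replace the direction of [v] by its negative, which leaves the squared
   inner product unchanged. *)
rewrite -sqrrN -sumrN.
under [X in _ <= X ^+ 2]eq_bigr do rewrite -mulrN.
apply: (@unit_projection_ge _ _ (fun l => - direction f v l)); rewrite ?direction_unit //.
  by under eq_bigr do rewrite sqrrN; rewrite direction_unit.
rewrite -sumc; apply: ler_sum => l _; apply: small.
apply: (@stair_close _ N Q i); rewrite ?mulrN ?normrN ?scaled_direction_le //.
by apply: rnd_close; rewrite stairN rndN (eqP (uv l)) opprK.
Qed.

End Shift.

(** * Assembling the sub-bipartition *)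

(* Sums over ordered pairs: twice the numerator of [rayleigh_bar]. *)
Definition energy (R : realType) (V : finType) (w : V -> V -> R) (k : nat)
    (f : 'I_k -> V -> R) : R :=
  \sum_u \sum_v w u v * sqnorm_sum f u v.

Lemma sqnorm_sumC (R : realType) (V : finType) (k : nat) (f : 'I_k -> V -> R) u v :
  sqnorm_sum f u v = sqnorm_sum f v u.
Proof. by apply: eq_bigr => l _; rewrite addrC. Qed.

(** Over all translates the loss is at most [k * k], so the factor 2 of Markov and [N = 8k^2] give
    1/4. The energies add up to at most [8 (Q N)^2] times [energy w f], with 4 for each endpoint,
    whence [16 Q^2 N]. *)
Lemma exists_good_shift (R : realType) (V : finType) (w : V -> V -> R) (k N Q : nat)
    (f : 'I_k -> V -> R) :
    is_weighted_graph w -> orthonormal_mu w f -> (0 < k)%N -> N = (8 * k ^ 2)%N ->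
  exists i : 'I_N,
    \sum_u deg w u * ((1 - cutoff (shifted f N Q i) u ^+ 2) * sqnorm f u) <= 1 / 4 /\
    \sum_u \sum_v w u v * ((\sum_l (shifted f N Q i u l + shifted f N Q i v l) ^+ 2)
                           * (sqnorm f u + sqnorm f v))
      <= 16 * Q%:R ^+ 2 * N%:R * energy w f.
Proof.
move=> wG fO k0 NE; have [w0 wC wD d0] := wG.
have k1 : 1 <= k%:R :> R by rewrite ler1n.
have NR : N%:R = 8 * k%:R ^+ 2 :> R by rewrite NE natrM natrX.
have N0 : (0 < N)%N by rewrite NE muln_gt0 expn_gt0 k0.
have sn0 u : 0 <= sqnorm f u := sqnorm_ge0 f u.
pose h (i : 'I_N) := shifted f N Q i.
have c1 i u : 0 <= 1 - cutoff (h i) u ^+ 2.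
  by have /andP[? ?] := cutoff_itv (h i) u; rewrite subr_ge0 expr_le1.
have D0 i u v : 0 <= \sum_l (h i u l + h i v l) ^+ 2.
  by apply: sumr_ge0 => l _; apply: sqr_ge0.
have [||||||i [hx hy]] := @exists_two_markov R N
  (fun i => \sum_u deg w u * ((1 - cutoff (h i) u ^+ 2) * sqnorm f u))
  (fun i => \sum_u \sum_v w u v * ((\sum_l (h i u l + h i v l) ^+ 2)
                                   * (sqnorm f u + sqnorm f v)))
  (k%:R ^+ 2) (8 * (Q * N)%:R ^+ 2 * energy w f).
- by [].
- by nra.
- by move=> i; apply: sumr_ge0 => u _; rewrite !mulr_ge0 // ltW.
- by move=> i; do 2!apply: sumr_ge0 => ? _; rewrite !mulr_ge0 ?addr_ge0.
- rewrite expr2 -{2}(sum_deg_sqnorm fO) mulr_sumr exchange_big; apply: ler_sum => u _ /=.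
  rewrite -mulr_sumr -mulr_suml [leRHS]mulrCA ler_wpM2l ?(ltW (d0 u)) // ler_wpM2r //.
  exact: sum_cutoff_loss_le.
- rewrite /energy exchange_big mulr_sumr; apply: ler_sum => u _ /=.
  rewrite exchange_big mulr_sumr; apply: ler_sum => v _ /=.
  rewrite -mulr_sumr -mulr_suml [leRHS]mulrCA ler_wpM2l //.
  apply: le_trans (ler_wpM2r _ (sum_shifted_energy_le f N Q u v)) _; first exact: addr_ge0.
  set d := \sum_l (direction f u l + _) ^+ 2.
  have hu : sqnorm f u * d <= 4 * sqnorm_sum f u v := sqnorm_mul_direction_le f u v.
  have hv : sqnorm f v * d <= 4 * sqnorm_sum f u v.
    rewrite sqnorm_sumC; apply: le_trans (sqnorm_mul_direction_le f v u).
    rewrite le_eqVlt; apply/orP; left; apply/eqP; congr (_ * _).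
    by apply: eq_bigr => l _; rewrite addrC.
  have := ler_wpM2l (sqr_ge0 (Q * N)%:R) (lerD hu hv); lra.
exists i; split; rewrite -(@ler_pM2l _ N%:R) ?ltr0n //.
  by apply: le_trans hx _; rewrite NR; lra.
apply: le_trans hy _; rewrite natrM; lra.
Qed.

Lemma exists_localization (R : realType) (V : finType) (w : V -> V -> R) (k : nat)
    (f : 'I_k -> V -> R) :
    is_weighted_graph w -> orthonormal_mu w f -> (0 < k)%N ->
  exists psi : 'I_k -> V -> R,
    (forall i j v, psi i v != 0 -> psi j v != 0 -> i = j) /\
    forall j, 0 < \sum_u deg w u * psi j u ^+ 2 /\
      \sum_u \sum_v w u v * (psi j u + psi j v) ^+ 2
        <= (2 ^+ 17 * k%:R ^+ 4 * energy w f) * \sum_u deg w u * psi j u ^+ 2.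
Proof.
move=> wG fO k0; have [w0 wC wD d0] := wG.
have k1 : 1 <= k%:R :> R by rewrite ler1n.
pose N := (8 * k ^ 2)%N; pose Q := (6 * k)%N.
have [i [loss en]] := @exists_good_shift R V w k N Q f wG fO k0 erefl.
set h := shifted f N Q i in loss en.
pose c : R := 4 * k%:R / (4 * k%:R - 1).
have cE : c * (4 * k%:R - 1) = 4 * k%:R by rewrite divfK // gt_eqF //; lra.
have sn0 u : 0 <= sqnorm f u := sqnorm_ge0 f u.
pose m (t : {set V}) := \sum_(u | cluster h u == t) deg w u * (cutoff h u ^+ 2 * sqnorm f u).
have m0 u : 0 <= deg w u * (cutoff h u ^+ 2 * sqnorm f u).
  by rewrite mulr_ge0 ?(ltW (d0 u)) // mulr_ge0 ?sqr_ge0.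
have [|||g hg] := @greedy_grouping R _ m c k [set: {set V}].
- by rewrite /c ler_pdivlMr; lra.
- move=> t; apply/andP; split; first by apply: sumr_ge0.
  apply: le_trans (cluster_mass_le t wG fO k0 erefl (ltn_ord i)).
  apply: ler_sum => u _; rewrite ler_wpM2l ?(ltW (d0 u)) // ler_piMl //.
  by have /andP[? ?] := cutoff_itv h u; rewrite expr_le1.
(* Since [c = 1 + 1 / (4k - 1)], the excess [(k - 1) / (4k - 1)] is at most 1/4, so
   [(k - 1) c + 1/2 <= k - 1/4], the mass that survives the cutoff. *)
- apply: (@le_trans _ _ (k%:R - 1 / 4)); first by nra.
  have -> : \sum_(t in [set: {set V}]) m t = \sum_u deg w u * (cutoff h u ^+ 2 * sqnorm f u).
    by rewrite [RHS](partition_big (cluster h) (in_mem^~ (mem [set: {set V}]))).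
  have := sum_deg_sqnorm fO; rewrite -subr_ge0 in loss.
  suff -> : \sum_u deg w u * (cutoff h u ^+ 2 * sqnorm f u) =
    \sum_u deg w u * sqnorm f u - \sum_u deg w u * ((1 - cutoff h u ^+ 2) * sqnorm f u) by lra.
  by rewrite -sumrB; apply: eq_bigr => u _; ring.
pose G u := g (cluster h u).
have GE x y : cluster h x = cluster h y -> G x = G y by rewrite /G => ->.
pose P (j l : 'I_k) u := (G u == j)%:R * cutoff h u * f l u.
have E0 : 0 <= energy w f.
  by do 2!apply: sumr_ge0 => ? _; rewrite mulr_ge0 // sumr_ge0 // => l _; apply: sqr_ge0.
have massE (j : 'I_k) : 1 / 2 <= \sum_l \sum_u deg w u * P j l u ^+ 2.
  apply: le_trans (hg j (ltn_ord j)) _.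
  have -> : \sum_l \sum_u deg w u * P j l u ^+ 2
      = \sum_(u | G u == j) deg w u * (cutoff h u ^+ 2 * sqnorm f u).
    rewrite exchange_big [RHS]big_mkcond; apply: eq_bigr => u _ /=.
    rewrite -mulr_sumr /P; case: (G u == j); last first.
      by rewrite big1 ?mulr0 // => l _; rewrite !mul0r expr0n.
    congr (_ * _); rewrite [in RHS]/sqnorm mulr_sumr; apply: eq_bigr => l _.
    by rewrite mul1r exprMn.
  rewrite [leRHS](partition_big (cluster h) (fun t => g t == j)) //=.
  rewrite le_eqVlt; apply/orP; left; apply/eqP.
  apply: eq_big => [t|t /andP[_ /eqP gt]]; first by rewrite inE.
  by apply: eq_bigl => u; rewrite /G; case: eqP => [->|]; rewrite ?gt ?eqxx ?andbF.
have enE (j : 'I_k) : \sum_l \sum_u \sum_v w u v * (P j l u + P j l v) ^+ 2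
    <= 2 ^+ 16 * k%:R ^+ 4 * energy w f.
  apply: (@le_trans _ _ (2 * energy w f + 8 * (16 * Q%:R ^+ 2 * N%:R * energy w f))); last first.
    have -> : Q%:R = 6 * k%:R :> R by rewrite natrM.
    have -> : N%:R = 8 * k%:R ^+ 2 :> R by rewrite natrM natrX.
    have : 1 <= k%:R ^+ 4 :> R by rewrite exprn_ege1.
    (* Here [8 * 16 * 36 * 8 = 9 * 2^12], and [2 + 9 * 2^12 <= 2^16]. *)
    have -> : 2 * energy w f + 8 * (16 * (6 * k%:R) ^+ 2 * (8 * k%:R ^+ 2) * energy w f)
      = (2 + 9 * 2 ^+ 12 * k%:R ^+ 4) * energy w f by ring.
    by move=> k4; rewrite ler_wpM2r //; lra.
  apply: le_trans (lerD (lexx _) (ler_wpM2l _ en)); last by [].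
  rewrite exchange_big /energy !mulr_sumr -big_split; apply: ler_sum => u _ /=.
  rewrite exchange_big !mulr_sumr -big_split; apply: ler_sum => v _ /=.
  rewrite -mulr_sumr.
  by have := ler_wpM2l (w0 u v) (localized_edge_le f j u v GE); rewrite -/h /P; lra.
(* Passing to the best coordinate does not increase the ratio of energy to mass; mass at least 1/2
   doubles [2^16] to [2^17]. *)
have sel (j : 'I_k) : exists l, 0 < \sum_u deg w u * P j l u ^+ 2 /\
    \sum_u \sum_v w u v * (P j l u + P j l v) ^+ 2
      <= 2 ^+ 17 * k%:R ^+ 4 * energy w f * \sum_u deg w u * P j l u ^+ 2.
  case: (@exists_mediant R _ (index_enum 'I_k)
    (fun l => \sum_u \sum_v w u v * (P j l u + P j l v) ^+ 2)
    (fun l => \sum_u deg w u * P j l u ^+ 2) (2 ^+ 17 * k%:R ^+ 4 * energy w f)).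
  - by move=> l _; do 2!apply: sumr_ge0 => ? _; rewrite mulr_ge0 ?sqr_ge0.
  - by move=> l _; apply: sumr_ge0 => u _; rewrite mulr_ge0 ?sqr_ge0 // ltW.
  - by apply: lt_le_trans (massE j); rewrite divr_gt0.
  - apply: le_trans (enE j) _.
    have : 0 <= 2 ^+ 16 * k%:R ^+ 4 * energy w f by rewrite !mulr_ge0 ?exprn_ge0.
    by move=> X0; have := ler_wpM2l X0 (massE j); lra.
  by move=> l _ hl; exists l.
have [s hs] := fin_all_exists sel.
exists (fun j => P j (s j)); split; last exact: hs.
have PG j l u : P j l u != 0 -> G u = j.
  by rewrite /P; case: (G u =P j) => // _; rewrite !mul0r eqxx.
by move=> j j' v /PG e /PG e'; apply: ord_inj; rewrite -e -e'.
Qed.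

(** The denominator of [rayleigh_bar] is the total mass [k]. Ordered pairs count each edge twice,
    and the diagonal vanishes since [w u u = 0]. *)
Lemma energyE (R : realType) (V : finType) (w : V -> V -> R) (k : nat) (f : 'I_k -> V -> R) :
    is_weighted_graph w -> orthonormal_mu w f -> (0 < k)%N ->
  energy w f = 2 * (k%:R * rayleigh_bar w f).
Proof.
move=> [w0 wC wD d0] fO k0; rewrite /rayleigh_bar.
under [X in _ / X]eq_bigr do rewrite mulrC.
rewrite (sum_deg_sqnorm fO) mulrC [k%:R * _]mulrC divfK ?pnatr_eq0 -?lt0n //.
set S := \sum_u _; have symE u v : sqnorm_sum f u v * w u v = sqnorm_sum f v u * w v u.
  by rewrite wC sqnorm_sumC.
have SE : S = \sum_u \sum_(v | (enum_rank v < enum_rank u)%N) sqnorm_sum f u v * w u v.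
  rewrite /S (exchange_big_dep xpredT) //=.
  by apply: eq_bigr => u _; apply: eq_bigr => v _; apply: symE.
rewrite mulr_natr mulr2n {2}SE /S -big_split; apply: eq_bigr => u _ /=.
rewrite (bigID (fun v => (enum_rank u < enum_rank v)%N)) /=; congr (_ + _).
  by apply: eq_bigr => v _; rewrite mulrC.
rewrite (bigD1 u) ?ltnn //= wD mul0r add0r; apply: eq_big => [v|v _]; last by rewrite mulrC.
by rewrite -leqNgt ltn_neqAle (inj_eq val_inj) (inj_eq enum_rank_inj) andbC.
Qed.

Theorem theorem6p1 :
  exists C : Rdefinitions.R, 0 < C /\
  forall (V : finType) (w : V -> V -> Rdefinitions.R) (k : nat)
         (f : 'I_k -> V -> Rdefinitions.R),
    is_weighted_graph w -> orthonormal_mu w f ->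
    exists P Q : 'I_k -> {set V},
      sub_bipartition P Q /\
      forall i : 'I_k,
        (1 - phibar w (P i) (Q i)) ^+ 2 / 2
          <= 1 - Num.sqrt (1 - (1 - phibar w (P i) (Q i)) ^+ 2)
        /\ 1 - Num.sqrt (1 - (1 - phibar w (P i) (Q i)) ^+ 2)
          <= C * (k%:R) ^+ 6 * rayleigh_bar w f.
Proof.
(* [2^17 k^4] times [energy w f], which is [2k] times the Rayleigh quotient, gives [2^18 k^5]; the
   sixth power of [k] leaves room. *)
exists (2 ^+ 18); split=> [|V w k f wG fO]; first by rewrite exprn_gt0.
case: (posnP k) => [k0|k0].
  have no (i : 'I_k) : False by case: i => i; rewrite k0.
  by exists (fun=> set0), (fun=> set0); split; [split|] => i; case: (no i).
have [psi [sep loc]] := exists_localization wG fO k0.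
have sel (j : 'I_k) : exists PQ : {set V} * {set V}, [/\ [disjoint PQ.1 & PQ.2],
    PQ.1 :|: PQ.2 != set0, {in PQ.1 :|: PQ.2, forall v, psi j v != 0},
    0 <= 1 - phibar w PQ.1 PQ.2 <= 1 &
    (1 - phibar w PQ.1 PQ.2) ^+ 2 <= 2 ^+ 17 * k%:R ^+ 4 * energy w f].
  have [M0 hM] := loc j; have [P [Q hPQ]] := dual_cheeger wG M0 hM.
  by exists (P, Q).
have [pq hpq] := fin_all_exists sel.
have dis (i j : 'I_k) (A B : {set V}) : i != j ->
    A \subset (pq i).1 :|: (pq i).2 -> B \subset (pq j).1 :|: (pq j).2 -> [disjoint A & B].
  move=> ij AS BS; apply/pred0P => v /=; apply/negP => /andP[/(subsetP AS) vi /(subsetP BS) vj].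
  have [_ _ hi _ _] := hpq i; have [_ _ hj _ _] := hpq j.
  by move: ij; rewrite (sep i j v (hi v vi) (hj v vj)) eqxx.
exists (fun i => (pq i).1), (fun i => (pq i).2); split.
  by split=> [i|i j ij|i j ij|i j ij|i]; do ?[by case: (hpq i)];
    apply: (dis i j) => //; rewrite ?subsetUl ?subsetUr.
move=> i; have [_ _ _ /andP[t0 t1] tL] := hpq i.
set t := 1 - phibar _ _ _ in t0 t1 tL *.
have s0 : 0 <= t ^+ 2 by apply: sqr_ge0.
have s1 : t ^+ 2 <= 1 by rewrite expr_le1.
set q := Num.sqrt _; have q0 : 0 <= q by apply: sqrtr_ge0.
have qE : q ^+ 2 = 1 - t ^+ 2 by rewrite sqr_sqrtr // subr_ge0.
(* With [t^2 = 1 - q^2], the gap [1 - q - t^2 / 2] equals [(1 - q)^2 / 2]. *)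
split; first by have := sqr_ge0 (1 - q); lra.
have k1 : 1 <= k%:R :> Rdefinitions.R by rewrite ler1n.
(* [1 - sqrt (1 - s) <= s] on [0, 1]. *)
apply: (@le_trans _ _ (t ^+ 2)); first by nra.
apply: le_trans tL _; rewrite (energyE wG fO k0).
have E0 : 0 <= energy w f.
  case: wG => w0 _ _ _; do 2!apply: sumr_ge0 => ? _.
  by rewrite mulr_ge0 // sumr_ge0 // => l _; apply: sqr_ge0.
have r0 : 0 <= rayleigh_bar w f.
  by move: E0; rewrite (energyE wG fO k0) pmulr_rge0 // pmulr_rge0 // ltr0n.
have -> : 2 ^+ 17 * k%:R ^+ 4 * (2 * (k%:R * rayleigh_bar w f))
  = (2 ^+ 18 * k%:R ^+ 5) * rayleigh_bar w f by ring.
by rewrite ler_wpM2r // ler_wpM2l ?exprn_ge0 // ler_weXn2l.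
Qed.
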